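(* Let $A$ and $B$ be irreducible square matrices of size greater than $1$ with entries in $\{0,1\}$ satisfying condition (I). Let $h:X_A\to X_B$ be a homeomorphism, and let $k_1,l_1:X_A\to\mathbb{Z}_+$ and $k_2,l_2:X_B\to\mathbb{Z}_+$ be continuous functions with $$\sigma_B^{k_1(x)}(h(\sigma_A(x)))=\sigma_B^{l_1(x)}(h(x))\ (x\in X_A),\qquad \sigma_A^{k_2(y)}(h^{-1}(\sigma_B(y)))=\sigma_A^{l_2(y)}(h^{-1}(y))\ (y\in X_B).$$ Then the class $[c_1]\in H^A$ of the function $c_1(x)=l_1(x)-k_1(x)$, $x\in X_A$, is a positive element of the ordered cohomology group $(H^A,H^A_+)$, i.e. $[c_1]\in H^A_+$, and $[c_1]$ is an order unit of $(H^A,H^A_+)$.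
   Context: For an $N\times N$ matrix $A$ ($N>1$) with entries in $\{0,1\}$, $X_A=\{(x_n)_{n\ge1}\in\{1,\dots,N\}^{\mathbb{N}}: A(x_n,x_{n+1})=1\ \forall n\ge1\}$ with the product topology, and $\sigma_A:X_A\to X_A$ is the shift $(x_n)_n\mapsto(x_{n+1})_n$. Condition (I) is that of Cuntz and Krieger; for an irreducible matrix it says that $A$ is not a permutation matrix, equivalently $X_A$ has no isolated points. $\mathbb{Z}_+=\{0,1,2,\dots\}$. Ordered cohomology group: $H^A=C(X_A,\mathbb{Z})/\{\xi-\xi\circ\sigma_A:\xi\in C(X_A,\mathbb{Z})\}$, where $C(X_A,\mathbb{Z})$ is the group of continuous integer-valued functions, $[\xi]$ denotes the class of $\xi$, and $H^A_+=\{[\xi]:\xi\in C(X_A,\mathbb{Z}),\ \xi(x)\ge0\ \forall x\in X_A\}$. An order unit is an element $u\in H^A_+$ such that for every $a\in H^A$ there is $n\in\mathbb{N}$ with $nu-a\in H^A_+$ and $nu+a\in H^A_+$. *)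

(* Defs.v *)
From HB Require Import structures.
From mathcomp Require Import all_boot all_order all_algebra.
From mathcomp Require Import generic_quotient ring_quotient.
From mathcomp Require Import boolp classical_sets functions.
From mathcomp Require Import topology.

Set Implicit Arguments.
Unset Strict Implicit.
Unset Printing Implicit Defensive.

Import Order.TTheory GRing.Theory Num.Theory.
Local Open Scope classical_set_scope.
Local Open Scope ring_scope.
Local Open Scope quotient_scope.

Definition zero_one_matrix N (A : 'M[nat]_N) : Prop :=
  forall i j, A i j = 0%N \/ A i j = 1%N.

Definition irreducible N (A : 'M[nat]_N) : Prop :=
  forall i j, exists n : nat, (0 < n)%N /\ (0 < (A ^+ n) i j)%N.

Definition transition N (A : 'M[nat]_N) : rel 'I_N := fun i j => A i j == 1%N.

(* The word [i, w, i] is admissible and visits i only at its two ends. *)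
Definition first_return N (A : 'M[nat]_N) (i : 'I_N) (w : seq 'I_N) : Prop :=
  i \notin w /\ path (transition A) i (rcons w i).

(* Condition (I) of Cuntz and Krieger ("A class of C*-algebras and
   topological Markov chains"), in its original form: every symbol leads to
   a symbol having at least two different first-return words. *)
Definition condition_I N (A : 'M[nat]_N) : Prop :=
  forall i : 'I_N, exists j : 'I_N, connect (transition A) i j /\
    exists w1 w2 : seq 'I_N,
      [/\ w1 <> w2, first_return A j w1 & first_return A j w2].

(* Sequences are indexed from 0 instead of from 1, and the N symbols are the
   elements of 'I_N with the discrete topology. *)
Definition full_shift N : topologicalType :=
  prod_topology (fun _ : nat => discrete_topology 'I_N).

Definition markov_set N (A : 'M[nat]_N) : set (full_shift N) :=
  [set x | forall n, A (x n) (x n.+1) = 1%N].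

(* X_A, with the topology induced by the product topology *)
Definition markov_shift N (A : 'M[nat]_N) : topologicalType :=
  set_type (markov_set A).

Lemma shift_subproof N (A : 'M[nat]_N) (x : markov_shift A) :
  (fun n => \val x n.+1 : discrete_topology 'I_N) \in markov_set A.
Proof. by case: x => x /= /set_mem Ax; apply/mem_set => n /=; exact: Ax. Qed.

Definition shift N (A : 'M[nat]_N) (x : markov_shift A) : markov_shift A :=
  @exist _ (fun y => y \in markov_set A) _ (shift_subproof x).

Lemma shift_continuous N (A : 'M[nat]_N) : continuous (@shift N A).
Proof.
pose iota : markov_shift A -> full_shift N := @set_val _ (markov_set A).
have iota_cont : continuous iota.
  exact: (@initial_continuous _ _ (@set_val _ (markov_set A))).
have coord_cont n :
    continuous ((fun x => iota x n) : markov_shift A -> discrete_topology 'I_N).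
  move=> x; apply: (@continuous_comp _ _ _ iota (fun y => y n)).
    exact: iota_cont.
  exact: (@proj_continuous nat (fun _ => discrete_topology 'I_N) n).
apply: (@continuous_comp_initial _ _ _ (@set_val _ (markov_set A))) => x.
have FF : Filter ((iota \o @shift N A) y @[y --> x])
  by apply: fmap_filter; exact: nbhs_filter.
apply/(@cvg_sup (full_shift N) nat _ _ _ FF) => n U [V [[W oW <-] Wx WU]].
apply: (filterS WU).
apply: (coord_cont n.+1 x W); exact: open_nbhs_nbhs.
Qed.

(* C(X, Z), with Z discrete *)
Record Cint (X : topologicalType) := MkCint {
  Cint_fun :> X -> int;
  Cint_continuous : continuous (Cint_fun : X -> discrete_topology int) }.

HB.instance Definition _ (X : topologicalType) := gen_eqMixin (Cint X).
HB.instance Definition _ (X : topologicalType) := gen_choiceMixin (Cint X).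

Lemma Cint_ext (X : topologicalType) (f g : Cint X) : f =1 g -> f = g.
Proof.
case: f g => [f cf] [g cg] /= /funext fg; rewrite fg in cf *.
by congr MkCint; exact: Prop_irrelevance.
Qed.

Lemma comp2_continuous (X : topologicalType) (D E F : discreteTopologicalType)
    (op : D -> E -> F) (f : X -> D) (g : X -> E) :
  continuous f -> continuous g -> continuous (fun x => op (f x) (g x)).
Proof.
move=> cf cg x; apply/discrete_cvg.
have Hf : \forall y \near x, f y = f x by exact: (cf x _ (discrete_set1 (f x))).
have Hg : \forall y \near x, g y = g x by exact: (cg x _ (discrete_set1 (g x))).
by apply: filterS2 Hf Hg => y /= -> ->.
Qed.

Section CintZmodule.
Variable X : topologicalType.
Let Z : discreteTopologicalType := discrete_topology int.

Lemma comp_cont_subproof (Y : topologicalType) (f : Cint Y) (s : X -> Y) :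
  continuous s -> continuous ((fun x => f (s x)) : X -> Z).
Proof.
move=> cs x; apply: (@continuous_comp _ _ Z s f); first exact: cs.
exact: Cint_continuous.
Qed.
Definition comp_cont (Y : topologicalType) (f : Cint Y) (s : X -> Y)
  (cs : continuous s) : Cint X := MkCint (comp_cont_subproof (f := f) cs).

Definition Cint_zero : Cint X := MkCint (@cst_continuous X Z (0 : int)).

Lemma Cint_opp_subproof (f : Cint X) :
  continuous ((fun x => - f x) : X -> Z).
Proof.
by apply: (@comp2_continuous X Z Z Z (fun a _ => - (a : int)) f f);
  exact: Cint_continuous.
Qed.
Definition Cint_opp (f : Cint X) : Cint X :=
  MkCint (Cint_opp_subproof (f := f)).

Lemma Cint_add_subproof (f g : Cint X) :
  continuous ((fun x => f x + g x) : X -> Z).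
Proof.
by apply: (@comp2_continuous X Z Z Z (fun a b => (a : int) + b) f g);
  exact: Cint_continuous.
Qed.
Definition Cint_add (f g : Cint X) : Cint X :=
  MkCint (Cint_add_subproof (f := f) (g := g)).

Lemma Cint_addA : associative Cint_add.
Proof. by move=> f g h; apply: Cint_ext => x; exact: addrA. Qed.
Lemma Cint_addC : commutative Cint_add.
Proof. by move=> f g; apply: Cint_ext => x; exact: addrC. Qed.
Lemma Cint_add0 : left_id Cint_zero Cint_add.
Proof. by move=> f; apply: Cint_ext => x; exact: add0r. Qed.
Lemma Cint_addN : left_inverse Cint_zero Cint_opp Cint_add.
Proof. by move=> f; apply: Cint_ext => x; exact: addNr. Qed.

HB.instance Definition _ :=
  GRing.isZmodule.Build (Cint X) Cint_addA Cint_addC Cint_add0 Cint_addN.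

Lemma Cint_addE (f g : Cint X) x : (f + g) x = f x + g x.
Proof. by []. Qed.
Lemma Cint_oppE (f : Cint X) x : (- f) x = - f x.
Proof. by []. Qed.
Lemma Cint_0E x : (0 : Cint X) x = 0.
Proof. by []. Qed.

Lemma nat_diff_subproof (l k : X -> nat) :
  continuous l -> continuous k ->
  continuous ((fun x => (l x)%:Z - (k x)%:Z) : X -> Z).
Proof.
exact: (@comp2_continuous X nat nat Z (fun a b => a%:Z - b%:Z)).
Qed.

Definition nat_diff (l k : X -> nat) (cl : continuous l) (ck : continuous k) :
  Cint X := MkCint (nat_diff_subproof cl ck).

Lemma nat_diffE (l k : X -> nat) (cl : continuous l) (ck : continuous k) x :
  nat_diff cl ck x = (l x)%:Z - (k x)%:Z.
Proof. by []. Qed.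

End CintZmodule.

Section Cohomology.
Variables (N : nat) (A : 'M[nat]_N).

Definition comp_shift (xi : Cint (markov_shift A)) : Cint (markov_shift A) :=
  comp_cont xi (@shift_continuous N A).

Lemma comp_shiftE xi x : comp_shift xi x = xi (shift x).
Proof. by []. Qed.

Definition coboundary : {pred Cint (markov_shift A)} :=
  fun f => `[< exists xi : Cint (markov_shift A), f = xi - comp_shift xi >].

Lemma coboundary_zmod_closed : zmod_closed coboundary.
Proof.
split; first by apply/asboolP; exists 0; apply: Cint_ext => x.
move=> f g /asboolP[u ->] /asboolP[v ->]; apply/asboolP; exists (u - v).
apply: Cint_ext => x; rewrite !(Cint_addE, Cint_oppE, comp_shiftE).
by rewrite !opprB [v _ - v x]addrC addrACA [- u _ + _]addrC.
Qed.

HB.instance Definition _ :=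
  GRing.isZmodClosed.Build (Cint (markov_shift A)) coboundary
    coboundary_zmod_closed.

Definition cohomology : zmodType := Quotient.quot coboundary.

Definition coh_class (xi : Cint (markov_shift A)) : cohomology :=
  \pi_(Quotient.quot coboundary) xi.

Definition coh_pos : set cohomology :=
  [set a | exists2 xi : Cint (markov_shift A),
             (forall x, 0 <= xi x) & coh_class xi = a].

Lemma coh_class_eq (f g : Cint (markov_shift A)) :
  coh_class f = coh_class g <->
  exists xi : Cint (markov_shift A), f - g = xi - comp_shift xi.
Proof.
split=> [/eqP|H]; last apply/eqP.
- by rewrite -Quotient.idealrBE => /asboolP.
- by rewrite -Quotient.idealrBE; apply/asboolP.
Qed.

Lemma coh_classB (f g : Cint (markov_shift A)) :
  coh_class (f - g) = coh_class f - coh_class g.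
Proof. exact: (raddfB \pi_(Quotient.quot coboundary)). Qed.

End Cohomology.

Definition order_unit (H : zmodType) (Hpos : set H) (u : H) : Prop :=
  Hpos u /\ forall a : H, exists n : nat,
    [/\ (0 < n)%N, Hpos (u *+ n - a) & Hpos (u *+ n + a)].

(* Main.v *)
(* The shift germ at a periodic point x of period p is expanding, and h carries
   it to an expanding germ at h x, which acts on tails as shift^L followed by
   an inverse branch of shift^K, where L and K are the sums of l1 and k1 along
   the orbit of x.  Since x is not isolated, this forces L > K.  So c1 has a
   positive sum along every periodic orbit.
   For an irreducible matrix a continuous f with this property is cohomologous
   to a nonnegative function: Birkhoff sums are bounded below, because orbit
   segments close up at bounded cost, and
     xi x = min {f y + ... + f (shift^(n-1) y) | shift^n y = x}
   satisfies xi (shift x) <= xi x + f x and depends on finitely many symbols.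
   A nonnegative function with positive sums on cycles has, by pigeonhole, some
   Birkhoff sum of length K which is at least 1 everywhere; its class is K
   times that of f, whence the order unit. *)
Require Import Defs.
From mathcomp Require Import all_boot all_order all_algebra.
From mathcomp Require Import generic_quotient zify.
From mathcomp Require Import boolp classical_sets functions cardinality.
From mathcomp Require Import topology.

Set Implicit Arguments.
Unset Strict Implicit.
Unset Printing Implicit Defensive.

Import Order.TTheory GRing.Theory Num.Theory.
Local Open Scope classical_set_scope.
Local Open Scope ring_scope.

(** * Cylinders as neighbourhood bases, and compactness *)

Lemma full_shift_nbhsP N (z : full_shift N) (U : set (full_shift N)) :
  nbhs z U -> exists n, forall t : full_shift N,
    (forall i, (i < n)%N -> t i = z i) -> U t.
Proof.
pose cyl n := [set t : full_shift N | forall i, (i < n)%N -> t i = z i].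
pose F := filter_from setT cyl.
have FF : Filter F.
  apply: filter_from_filter; first by exists 0%N.
  move=> m n _ _; exists (maxn m n) => // t tz.
  by split=> i lt_i; apply: tz; rewrite leq_max lt_i ?orbT.
(* The cylinders generate a filter; its coordinatewise convergence to [z] makes it finer than the
   neighbourhood filter. *)
suff Fz : F --> z by move=> /Fz[n _ sU]; exists n => t tz; exact: sU.
apply/(@cvg_sup (full_shift N) nat _ _ _ FF) => i V [W [[T oT <-] Tz WV]].
by exists i.+1 => // t tz; apply: WV; rewrite /= (tz i).
Qed.

Lemma full_shift_nbhs_cylinder N (z : full_shift N) n :
  nbhs z [set t : full_shift N | forall i, (i < n)%N -> t i = z i].
Proof.
elim: n => [|n IHn]; first by apply: filterS filterT.
have zn : nbhs z [set t : full_shift N | t n = z n].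
  exact: (@proj_continuous nat (fun _ => discrete_topology 'I_N) n z
    [set z n] (discrete_set1 (z n : discrete_topology 'I_N))).
apply: filterS2 IHn zn => t /= tz tn i.
by rewrite ltnS leq_eqVlt => /orP[/eqP->//|]; exact: tz.
Qed.

Section MarkovShift.
Variables (N : nat) (A : 'M[nat]_N).
Local Notation X := (markov_shift A).

Definition letter (x : X) (i : nat) : 'I_N := \val x i.

Definition agree n (x y : X) := forall i, (i < n)%N -> letter y i = letter x i.

Lemma markov_shift_eq (x y : X) : letter x =1 letter y -> x = y.
Proof. by move=> xy; apply: val_inj; apply: funext => i; exact: xy. Qed.

Lemma letter_iter n x i : letter (iter n (@shift N A) x) i = letter x (n + i).
Proof. by elim: n i => //= n IHn i; rewrite addSnnS -IHn. Qed.

Lemma agree_leq m n x y : (m <= n)%N -> agree n x y -> agree m x y.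
Proof. by move=> mn xy i im; apply: xy; exact: leq_trans im mn. Qed.

Lemma markov_nbhsP (x : X) (U : set X) :
  nbhs x U <-> exists n, forall y, agree n x y -> U y.
Proof.
split=> [[V [[W oW <-] Wx VU]]|[n nU]].
  have [n nW] := full_shift_nbhsP (open_nbhs_nbhs (conj oW Wx)).
  by exists n => y xy; apply: VU; apply: nW => i /xy.
have xn : nbhs x [set y : X | forall i, (i < n)%N -> \val y i = \val x i].
  exact: (@initial_continuous _ _ (@set_val _ (markov_set A)) x _
    (@full_shift_nbhs_cylinder N (\val x) n)).
apply: (@filterS _ (nbhs x) (nbhs_filter x) _ _ _ xn) => y xy.
by apply: nU => i /xy.
Qed.

(** Turns local bounds into uniform ones. Tychonoff makes the full shift compact, so the covering
    argument runs there instead of on the subspace. *)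
Lemma markov_compact (Q : nat -> X -> Prop) :
  (forall x, exists n, forall m y, (n <= m)%N -> agree n x y -> Q m y) ->
  exists m, forall x, Q m x.
Proof.
move=> locQ.
have /compact_near_coveringP cpt : compact [set: full_shift N].
  have -> : [set: full_shift N] = [set f | forall i, setT (f i)].
    by apply/seteqP; split.
  apply: (@tychonoff nat (fun _ => discrete_topology 'I_N) (fun _ => setT)).
  move=> _; apply: finite_compact; exact: finite_finset.
pose P m (z : full_shift N) := forall x : X, \val x = z -> Q m x.
have [] := cpt nat \oo P _ _.
  move=> z _; have [Az|nAz] := pselect (markov_set A z).
    pose x : X := exist _ z (mem_set Az).
    have [n nQ] := locQ x.
    exists ([set t : full_shift N | forall i, (i < n)%N -> t i = z i],
            [set m | (n <= m)%N]).
      by split; [exact: full_shift_nbhs_cylinder|exists n].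
    move=> [t m] [/= tz nm] y yt; apply: (nQ m y nm) => i /tz.
    by rewrite /letter yt.
  (* A forbidden transition at [n] is visible in the first [n.+2] letters, so this cylinder misses
     the Markov shift and the claim is vacuous on it. *)
  have /existsNP[n nA] := nAz.
  exists ([set t : full_shift N | forall i, (i < n.+2)%N -> t i = z i], setT).
    by split; [exact: full_shift_nbhs_cylinder|exact: filterT].
  move=> [t m] [/= tz _] y yt; case: nA.
  have := set_mem (valP y) n; rewrite [\val y]yt.
  by rewrite (tz n) ?(tz n.+1).
by move=> m _ /(_ m (leqnn m)) Qm; exists m => x; exact: (Qm (\val x)).
Qed.

End MarkovShift.

(** * Admissible words, periodic points and absence of isolated points *)

Section Words.
Variables (N : nat) (A : 'M[nat]_N).
Local Notation X := (markov_shift A).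
Local Notation e := (transition A).

Lemma letter_transition (x : X) i : e (letter x i) (letter x i.+1).
Proof. by apply/eqP; exact: (set_mem (valP x) i). Qed.

Lemma markov_point (s : nat -> 'I_N) :
  (forall i, e (s i) (s i.+1)) -> exists x : X, letter x =1 s.
Proof.
move=> es; have As : markov_set A s by move=> i; apply/eqP/es.
by exists (exist _ (s : full_shift N) (mem_set As)).
Qed.

Definition segment (x : X) i n := [seq letter x j | j <- iota i n].

Lemma size_segment x i n : size (segment x i n) = n.
Proof. by rewrite size_map size_iota. Qed.

Lemma nth_segment a x i n j :
  (j < n)%N -> nth a (segment x i n) j = letter x (i + j).
Proof. by move=> jn; rewrite (nth_map 0%N) ?size_iota// nth_iota. Qed.

Lemma last_segment x i n :
  last (letter x i) (segment x i.+1 n) = letter x (i + n).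
Proof.
case: n => [|n]; first by rewrite addn0.
by rewrite (last_nth (letter x i)) size_segment /= nth_segment// addSnnS.
Qed.

Lemma path_segment x i n : path e (letter x i) (segment x i.+1 n).
Proof.
elim: n i => //= n IHn i; rewrite letter_transition; exact: IHn.
Qed.

Lemma prepend_word a w (z : X) : path e a w -> last a w = letter z 0 ->
  exists y : X, (forall i, (i <= size w)%N -> letter y i = nth a (a :: w) i) /\
                iter (size w) (@shift N A) y = z.
Proof.
move=> /(pathP a) ew lz.
(* The last letter of [a :: w] is the first letter of [z], so it is read from [z]. *)
pose s i := if (i < size w)%N then nth a (a :: w) i else letter z (i - size w).
have [|y ys] := @markov_point s.
  move=> i; rewrite /s; case: (ltnP i.+1 (size w)) => [lt_i|ge_i].
    by rewrite (ltnW lt_i) ew// ltnW.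
  case: (ltnP i (size w)) => [lt_i|{}ge_i]; last first.
    by rewrite subSn// letter_transition.
  have iw : i.+1 = size w by apply/eqP; rewrite eqn_leq lt_i.
  rewrite iw subnn -lz (last_nth a) -iw /=; exact: ew.
exists y; split=> [i|].
  rewrite ys /s leq_eqVlt => /orP[/eqP->|->//].
  by rewrite ltnn subnn -lz (last_nth a).
apply: markov_shift_eq => i; rewrite letter_iter ys /s.
by rewrite ltnNge leq_addr addKn.
Qed.

Lemma periodic_word a w : path e a (rcons w a) ->
  exists z : X, forall i, letter z i = nth a (a :: w) (i %% (size w).+1).
Proof.
move=> /(pathP a); rewrite size_rcons => ew.
apply: (@markov_point (fun i => nth a (a :: w) (i %% (size w).+1))) => i.
have r_lt : (i %% (size w).+1 < (size w).+1)%N by rewrite ltn_mod.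
rewrite -[i.+1]addn1 -modnDml addn1.
move: (_ %% _)%N r_lt => r r_lt.
have := ew _ r_lt; rewrite -rcons_cons nth_rcons /= r_lt.
(* At [r = size w] the index wraps to 0 and the next letter is the final [a] of [rcons w a]. *)
move: r_lt; rewrite ltnS leq_eqVlt => /orP[/eqP->|r_lt].
  by rewrite modnn nth_rcons ltnn eqxx.
by rewrite modn_small ?ltnS// nth_rcons r_lt.
Qed.

Lemma periodic_iter p (z : X) :
  (forall i, letter z (p + i) = letter z i) -> iter p (@shift N A) z = z.
Proof. by move=> zp; apply: markov_shift_eq => i; rewrite letter_iter zp. Qed.

Lemma irreducible_path : zero_one_matrix A -> irreducible A ->
  forall i j, exists w, path e i (rcons w j).
Proof.
move=> A01 Airr i j; have [n [n_gt0 An]] := Airr i j.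
case: n n_gt0 An => // n _; elim: n i => [|n IHn] i.
  rewrite expr1 => Aij; exists [::]; rewrite /= andbT /transition.
  by case: (A01 i j) Aij => ->.
rewrite exprS -mulmxE mxE => S_gt0.
have [k] : exists k, (0 < A i k * (A ^+ n.+1) k j)%N.
  move: S_gt0; rewrite lt0n => /eqP S_neq0; apply: contrapT => /forallNP P0.
  apply: S_neq0; apply: big1 => k _; apply/eqP; rewrite -leqn0 leqNgt.
  exact/negP/P0.
rewrite muln_gt0 => /andP[Aik /IHn[w ew]]; exists (k :: w).
by rewrite /= ew andbT /transition; case: (A01 i k) Aik => ->.
Qed.

Lemma irreducible_path_bounded : zero_one_matrix A -> irreducible A ->
  exists L, forall i j, exists w, (size w <= L)%N /\ path e i (rcons w j).
Proof.
move=> A01 Airr; have /choice[W eW] : forall ij : 'I_N * 'I_N,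
    exists w, path e ij.1 (rcons w ij.2).
  by move=> [i j]; exact: irreducible_path.
exists (\max_ij size (W ij)) => i j; exists (W (i, j)).
by split; [exact: leq_bigmax | exact: (eW (i, j))].
Qed.

(** If [w1] were shorter, its periodic sequence would be back at [a] while the other is still inside
    [w2], which avoids [a]. *)
Lemma first_return_periodic_inj a w1 w2 :
  first_return A a w1 -> first_return A a w2 ->
  (forall i, nth a (a :: w1) (i %% (size w1).+1) =
             nth a (a :: w2) (i %% (size w2).+1)) -> w1 = w2.
Proof.
wlog le12 : w1 w2 / (size w1 <= size w2)%N.
  move=> W fr1 fr2 eq12; have [le|/ltnW le] := leqP (size w1) (size w2).
    exact: W.
  by apply/esym/W => // i; rewrite eq12.
move=> [_ _] [aw2 _] eq12.
have sz12 : size w1 = size w2.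
  apply/eqP; rewrite eqn_leq le12 leqNgt; apply/negP => lt12.
  move: (eq12 (size w1).+1); rewrite modnn modn_small ?ltnS// => /= aE.
  by move: aw2; rewrite [in X in X \notin _]aE mem_nth.
apply: (@eq_from_nth _ a) => // i i_lt; have := eq12 i.+1.
by rewrite !modn_small ?ltnS// -sz12.
Qed.

(** Follow [x] up to its letter [n], go on to [j], then repeat [w1] or [w2] forever: the two
    continuations differ, so one of them is not [x]. *)
Lemma condition_I_no_isolated (x : X) n :
  condition_I A -> exists2 y, agree n x y & y <> x.
Proof.
move=> /(_ (letter x n))[j [/connectP[c ec jE] [w1 [w2 [w12 fr1 fr2]]]]].
have ext w : first_return A j w -> exists y, agree n x y /\
    forall i, letter y (n + size c + i) = nth j (j :: w) (i %% (size w).+1).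
  move=> [_ /periodic_word[z zE]].
  have [||y [yE yz]] := @prepend_word (letter x 0) (segment x 1 n ++ c) z.
  - by rewrite cat_path path_segment last_segment.
  - by rewrite last_cat last_segment zE mod0n.
  rewrite size_cat size_segment in yz yE.
  exists y; split=> i; last by rewrite -letter_iter yz.
  move=> i_lt; rewrite yE; last by rewrite (leq_trans (ltnW i_lt)) ?leq_addr.
  case: i i_lt => //= i i_lt.
  by rewrite nth_cat size_segment ltnW// nth_segment// ltnW.
have [[y1 [xy1 y1E]] [y2 [xy2 y2E]]] := (ext _ fr1, ext _ fr2).
have [y1x|] := pselect (y1 = x); last by exists y1.
have [y2x|] := pselect (y2 = x); last by exists y2.
case: w12; apply: (first_return_periodic_inj fr1 fr2) => i.
by rewrite -y1E -y2E y1x y2x.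
Qed.

End Words.

(** * Birkhoff sums and functions positive on cycles *)

Section Cocycles.
Variables (N : nat) (A : 'M[nat]_N).
Local Notation X := (markov_shift A).
Local Notation sigma := (@shift N A).

Lemma agree_sym n (x y : X) : agree n x y -> agree n y x.
Proof. by move=> xy i /xy. Qed.

Lemma agree_iter m n (x y : X) :
  agree (m + n) x y -> agree n (iter m sigma x) (iter m sigma y).
Proof. by move=> xy i i_lt; rewrite !letter_iter xy// ltn_add2l. Qed.

Lemma continuous_locally_constant (T : discreteTopologicalType) (g : X -> T) :
  continuous g -> forall x, exists n, forall y, agree n x y -> g y = g x.
Proof.
by move=> cg x; apply/markov_nbhsP; exact: (cg x _ (discrete_set1 (g x))).
Qed.

Lemma continuous_uniform (T : discreteTopologicalType) (g : X -> T) :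
  continuous g -> exists m, forall x y, agree m x y -> g y = g x.
Proof.
move=> cg; apply: (@markov_compact _ _
  (fun m x => forall y, agree m x y -> g y = g x)) => x.
have [n nP] := continuous_locally_constant cg x.
exists n => m y nm xy z yz; rewrite (nP _ xy) nP// => i i_lt.
by rewrite yz ?xy// (leq_trans i_lt).
Qed.

Lemma agree_continuous (g : X -> int) m :
  (forall x y, agree m x y -> g y = g x) ->
  continuous (g : X -> discrete_topology int).
Proof.
move=> gm x; apply/discrete_cvg.
  by apply: fmap_filter; exact: nbhs_filter.
have : nbhs x [set y | g y = g x] by apply/markov_nbhsP; exists m => y /gm.
exact.
Qed.

Lemma Cint_bounded (f : Cint X) : exists c : nat, forall x, `|f x| <= c%:Z.
Proof.
apply: (@markov_compact _ _ (fun c x => `|f x| <= c%:Z)) => x.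
have [n nP] := continuous_locally_constant (@Cint_continuous _ f) x.
exists (maxn n `|f x|%N) => m y; rewrite geq_max => /andP[nm fm] xy.
have -> : f y = f x by apply: nP; exact: (agree_leq (leq_maxl _ _) xy).
lia.
Qed.

Definition birkhoff (f : X -> int) n x := \sum_(i < n) f (iter i sigma x).

Lemma birkhoffS f n x :
  birkhoff f n.+1 x = birkhoff f n x + f (iter n sigma x).
Proof. exact: big_ord_recr. Qed.

Lemma birkhoffD f m n x :
  birkhoff f (m + n) x = birkhoff f m x + birkhoff f n (iter m sigma x).
Proof.
rewrite /birkhoff big_split_ord; congr (_ + _).
by apply: eq_bigr => i _; rewrite -iterD [(i + m)%N]addnC.
Qed.

Lemma birkhoff_agree (f : X -> int) m n x y :
  (forall x y, agree m x y -> f y = f x) ->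
  agree (n + m) x y -> birkhoff f n y = birkhoff f n x.
Proof.
move=> fm xy; apply: eq_bigr => i _; apply/fm/agree_iter.
by apply: agree_leq xy; rewrite leq_add2r ltnW.
Qed.

Lemma birkhoff_le (f : X -> int) (c : nat) n x :
  (forall x, `|f x| <= c%:Z) -> birkhoff f n x <= (n * c)%N%:Z.
Proof.
move=> fc; rewrite PoszM -[n%:Z]natz mulr_natl -{2}[n]card_ord -sumr_const.
by apply: ler_sum => i _; apply: le_trans (fc _); exact: ler_norm.
Qed.

Lemma birkhoff_ge0 (f : X -> int) n x :
  (forall x, 0 <= f x) -> 0 <= birkhoff f n x.
Proof. by move=> f0; apply: sumr_ge0. Qed.

Lemma birkhoff_coboundary (f g : X -> int) n x :
  birkhoff (fun x => f x + g x - g (sigma x)) n x =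
  birkhoff f n x + g x - g (iter n sigma x).
Proof.
elim: n => [|n IHn]; first by rewrite /birkhoff !big_ord0 add0r subrr.
rewrite !birkhoffS IHn /=; lia.
Qed.

Definition positive_on_cycles (f : X -> int) :=
  forall x p, (0 < p)%N -> iter p sigma x = x -> 0 < birkhoff f p x.

Section PositiveOnCycles.
Hypotheses (A01 : zero_one_matrix A) (Airr : irreducible A).

Lemma birkhoff_bounded_below (f : Cint X) :
  positive_on_cycles f -> exists C : nat, forall n x, - C%:Z <= birkhoff f n x.
Proof.
move=> fpos; have [m fm] := continuous_uniform (@Cint_continuous _ f).
have [c fc] := Cint_bounded f.
have [L LP] := irreducible_path_bounded A01 Airr.
(* Closing the first [n + m + 1] letters of [x] by a word [w] gives a cycle. Its first [n] terms are
   those of [x], thanks to the [m] extra letters; the other [m.+1 + size w] terms cost at most [c]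
   each. *)
exists ((m.+1 + L) * c)%N => n x.
have [w [wL ew]] := LP (letter x (n + m)) (letter x 0).
pose v := segment x 1 (n + m) ++ w.
have [|z zE] := @periodic_word _ A (letter x 0) v.
  by rewrite rcons_cat cat_path path_segment last_segment.
have sz_v : (size v).+1 = (n + (m.+1 + size w))%N.
  by rewrite size_cat size_segment addnA addnS.
have z_per : iter (size v).+1 sigma z = z.
  by apply: periodic_iter => i; rewrite !zE modnDl.
have xz : agree (n + m) x z.
  move=> i i_lt; rewrite zE modn_small; last by rewrite sz_v; lia.
  case: i i_lt => //= i i_lt.
  by rewrite nth_cat size_segment ltnW// nth_segment// ltnW.
have := fpos _ _ (ltn0Sn _) z_per.
rewrite sz_v birkhoffD (birkhoff_agree fm xz).
have := birkhoff_le (m.+1 + size w) (iter n sigma z) fc.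
have : ((m.+1 + size w) * c <= (m.+1 + L) * c)%N.
  by rewrite leq_mul2r leq_add2l wL orbT.
lia.
Qed.

(* [xi x] is the shortest path distance to [x] for the edge weights [f]. *)
Lemma positive_on_cycles_cohomologous (f : Cint X) :
  positive_on_cycles f ->
  exists xi : Cint X, forall x, 0 <= f x + xi x - xi (sigma x).
Proof.
move=> fpos; have [m fm] := continuous_uniform (@Cint_continuous _ f).
have [C fC] := birkhoff_bounded_below fpos.
have /choice[xi xiP] x : exists v : int,
    (exists n y, iter n sigma y = x /\ birkhoff f n y = v) /\
    forall n y, iter n sigma y = x -> v <= birkhoff f n y.
  (* Adding [C] makes all the sums natural numbers, so that a least one exists. *)
  pose P k := `[< exists n y, iter n sigma y = x /\
                              birkhoff f n y = k%:Z - C%:Z >].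
  have exP n y : iter n sigma y = x -> P (absz (birkhoff f n y + C%:Z)).
    move=> yx; apply/asboolP; exists n, y; split=> //.
    by have := fC n y; lia.
  case: (@ex_minnP P).
    by exists (absz (birkhoff f 0 x + C%:Z)); exact: exP.
  move=> k /asboolP Pk kmin; exists (k%:Z - C%:Z); split=> // n y yx.
  by have := kmin _ (exP _ _ yx); have := fC n y; lia.
(* The prefix of an optimal path to [x] is transplanted onto [y]. The extra letter in [m.+1] ensures
   that [x] and [y] share their first letter even if [m = 0]. *)
have xi_le x y : agree m.+1 x y -> xi y <= xi x.
  move=> xy; have [[n [t [tx <-]]] _] := xiP x; have [_ xi_min] := xiP y.
  have [||t' [t'E t'y]] := @prepend_word _ A (letter t 0) (segment t 1 n) y.
  - exact: path_segment.
  - by rewrite last_segment xy// -tx letter_iter addn0.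
  rewrite size_segment in t'E t'y.
  rewrite -(birkhoff_agree (y := t') fm); first exact: xi_min.
  move=> i i_lt; have [i_le|n_lt] := leqP i n.
    by rewrite t'E//; case: i i_lt i_le => //= i _ i_lt; rewrite nth_segment.
  rewrite -(subnKC (ltnW n_lt)) -!letter_iter t'y tx xy//.
  by rewrite ltnS leq_subLR ltnW.
have cxi := @agree_continuous xi m.+1 (fun x y xy =>
  le_anti (introT andP (conj (xi_le _ _ xy) (xi_le _ _ (agree_sym xy))))).
exists (MkCint cxi) => x /=.
have [[n [y [yx <-]]] _] := xiP x; have [_ xi_min] := xiP (sigma x).
rewrite subr_ge0 addrC (le_trans (xi_min n.+1 y _)) ?iterS ?yx//.
by rewrite birkhoffS yx.
Qed.

Lemma birkhoff_ge1 (f : Cint X) : (forall x, 0 <= f x) ->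
  positive_on_cycles f -> exists2 K, (0 < K)%N & forall x, 1 <= birkhoff f K x.
Proof.
move=> f0 fpos; have [m fm] := continuous_uniform (@Cint_continuous _ f).
(* [K] counts the words of length [m.+1], so two of the windows at positions 0 to [K] coincide;
   between them the orbit follows a cycle. *)
pose K := #|{ffun 'I_m.+1 -> 'I_N}|.
suff Kge1 x : 1 <= birkhoff f K x.
  (* If [K = 0], the bound says [1 <= 0] at every point, so there are no points and 1 will do. *)
  have [K0|K_gt0] := posnP K; last by exists K.
  exists 1%N => // x; have := Kge1 x.
  by rewrite K0 /birkhoff big_ord0.
pose W (i : 'I_K.+1) := [ffun t : 'I_m.+1 => letter x (i + t)].
have [i [j [lt_ij Wij]]] : exists i j : 'I_K.+1, (i < j)%N /\ W i = W j.
  have : ~ injective W by move=> /leq_card; rewrite card_ord ltnn.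
  move=> /existsNP[i /existsNP[j /not_implyP[Wij /eqP neq_ij]]].
  have [lt_ij|lt_ji|/val_inj eq_ij] := ltngtP i j.
  - by exists i, j.
  - by exists j, i.
  - by rewrite eq_ij eqxx in neq_ij.
pose q := (j - i).-1.
have jE : j = (i + q.+1)%N :> nat by rewrite /q; lia.
have [|z zE] := @periodic_word _ A (letter x i) (segment x i.+1 q).
  rewrite (_ : rcons _ _ = segment x i.+1 q.+1) ?path_segment//.
  rewrite /segment -[q.+1]addn1 iotaD map_cat cats1 /= addSnnS -jE.
  congr rcons; move/ffunP/(_ ord0): Wij; rewrite !ffunE /= !addn0.
  by [].
rewrite size_segment in zE.
have zq t : letter z (q.+1 + t) = letter z t by rewrite !zE modnDl.
(* Beyond one period, equality of the windows at [i] and [j] lets the letter be moved back by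
   [q.+1]. *)
have xz : agree (q.+1 + m) (iter i sigma x) z.
  move=> t; rewrite letter_iter; elim/ltn_ind: t => t IHt t_lt.
  have [t_le|q_lt] := leqP t q.
    rewrite zE modn_small//; case: t t_le {IHt t_lt} => [|t] t_lt /=.
      by rewrite addn0.
    by rewrite nth_segment// addSnnS.
  have tm : (t - q.+1 < m.+1)%N by lia.
  rewrite -(subnKC q_lt) zq IHt; [|lia..].
  rewrite addnA -jE.
  by move/ffunP/(_ (Ordinal tm)): Wij; rewrite !ffunE.
have := fpos _ _ (ltn0Sn q) (periodic_iter zq); rewrite (birkhoff_agree fm xz).
(* The middle block is the positive cycle sum; the outer two are nonnegative. *)
have -> : birkhoff f K x = birkhoff f (i + (q.+1 + (K - j))) x.
  by congr birkhoff; have := ltn_ord j; lia.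
rewrite !birkhoffD.
have := birkhoff_ge0 i x f0.
have := birkhoff_ge0 (K - j) (iter q.+1 sigma (iter i sigma x)) f0.
lia.
Qed.

End PositiveOnCycles.
End Cocycles.

(** * Order units of the cohomology group *)

Section Cohomology.
Variables (N : nat) (A : 'M[nat]_N).
Local Notation X := (markov_shift A).
Local Notation sigma := (@shift N A).

Lemma coh_class_comp_shift (f : Cint X) :
  coh_class (comp_shift f) = coh_class f.
Proof.
apply/coh_class_eq; exists (- f); apply: Cint_ext => x.
by rewrite !(Cint_addE, Cint_oppE, comp_shiftE) opprK addrC.
Qed.

Lemma coh_class0 : coh_class (0 : Cint X) = 0.
Proof. by rewrite -(subrr (0 : Cint X)) coh_classB subrr. Qed.

Lemma coh_classD (f g : Cint X) :
  coh_class (f + g) = coh_class f + coh_class g.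
Proof.
by rewrite -[g in LHS]opprK -[- g]add0r !coh_classB coh_class0 add0r opprK.
Qed.

Lemma coh_classMn (f : Cint X) n : coh_class (f *+ n) = coh_class f *+ n.
Proof. by elim: n => [|n IHn]; rewrite ?coh_class0// !mulrS coh_classD IHn. Qed.

Lemma Cint_mulrnE (f : Cint X) n x : (f *+ n) x = f x *+ n.
Proof. by elim: n => // n IHn; rewrite !mulrS Cint_addE IHn. Qed.

(** Composing with the shift does not change a class, so each term of the sum contributes the class
    of [f]. *)
Lemma coh_class_birkhoff (f : Cint X) n :
  exists2 F : Cint X, (forall x, F x = birkhoff f n x) &
    coh_class F = coh_class f *+ n.
Proof.
elim: n => [|n [F FE FC]].
  by exists 0 => [x|]; rewrite ?coh_class0// /birkhoff big_ord0.
exists (f + comp_shift F) => [x|].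
  by rewrite Cint_addE comp_shiftE FE -add1n birkhoffD /birkhoff big_ord1.
by rewrite coh_classD coh_class_comp_shift FC mulrS.
Qed.

Lemma coh_class_surj (a : cohomology A) : exists f, coh_class f = a.
Proof. by exists (repr a); exact: reprK. Qed.

Lemma order_unit_positive_on_cycles (f : Cint X) :
  zero_one_matrix A -> irreducible A -> positive_on_cycles f ->
  order_unit (@coh_pos N A) (coh_class f).
Proof.
move=> A01 Airr fpos.
have [xi xi0] := positive_on_cycles_cohomologous A01 Airr fpos.
pose g : Cint X := f + xi - comp_shift xi.
have g0 x : 0 <= g x by exact: xi0.
have gC : coh_class g = coh_class f.
  by rewrite coh_classB coh_classD coh_class_comp_shift addrK.
(* The coboundary telescopes to zero along a cycle. *)
have gpos : positive_on_cycles g.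
  move=> x p p_gt0 xp; have := birkhoff_coboundary f xi p x.
  by rewrite xp addrK => ->; exact: fpos.
rewrite -gC; split; first by exists g.
have [K K_gt0 K_ge1] := birkhoff_ge1 g0 gpos.
have [F FE FC] := coh_class_birkhoff g K.
move=> a; have [b <-] := coh_class_surj a; have [c bc] := Cint_bounded b.
(* Since [F] is at least 1, [F *+ c.+1] dominates both [b] and [- b]; [c.+1] keeps the multiple
   positive when [c = 0]. *)
exists (K * c.+1)%N; rewrite muln_gt0 K_gt0 mulrnA -FC -coh_classMn; split=> //.
- exists (F *+ c.+1 - b); last exact: coh_classB.
  move=> x; rewrite Cint_addE Cint_oppE Cint_mulrnE FE.
  by have := bc x; have := K_ge1 x; rewrite -mulr_natr; nia.
- exists (F *+ c.+1 + b); last exact: coh_classD.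
  move=> x; rewrite Cint_addE Cint_mulrnE FE.
  by have := bc x; have := K_ge1 x; rewrite -mulr_natr; nia.
Qed.

End Cohomology.

(** * Transport of periodic orbits by the orbit map *)

Lemma continuous_agree (N M : nat) (A : 'M[nat]_N) (B : 'M[nat]_M)
    (g : markov_shift A -> markov_shift B) m x :
  continuous g -> exists n, forall y, agree n x y -> agree m (g x) (g y).
Proof.
move=> cg; apply/markov_nbhsP.
by apply: (cg x [set z | agree m (g x) z]); apply/markov_nbhsP; exists m.
Qed.

Section OrbitMap.
Variables (N M : nat) (A : 'M[nat]_N) (B : 'M[nat]_M).
Variables (h : markov_shift A -> markov_shift B).
Variables (k l : markov_shift A -> nat).
Hypothesis orbit : forall x : markov_shift A,
  iter (k x) (@shift M B) (h (@shift N A x)) = iter (l x) (@shift M B) (h x).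

Definition time_sum (t : markov_shift A -> nat) p x :=
  (\sum_(i < p) t (iter i (@shift N A) x))%N.

Lemma orbit_iter p x :
  iter (time_sum k p x) (@shift M B) (h (iter p (@shift N A) x)) =
  iter (time_sum l p x) (@shift M B) (h x).
Proof.
rewrite /time_sum; elim: p => [|p IHp]; first by rewrite !big_ord0.
rewrite !big_ord_recr /= iterD orbit -iterD addnC iterD IHp -iterD.
by rewrite addnC.
Qed.

Lemma time_sum_locally_constant (t : markov_shift A -> nat) p x :
  continuous t ->
  exists n, forall y, agree n x y -> time_sum t p y = time_sum t p x.
Proof.
move=> ct; have [m tm] := continuous_uniform ct.
exists (p + m)%N => y xy; apply: eq_bigr => i _; apply/tm/agree_iter.
by apply: agree_leq xy; rewrite leq_add2r ltnW.
Qed.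

Variable (hinv : markov_shift B -> markov_shift A).
Hypotheses (hK : cancel h hinv).
Hypotheses (h_cont : continuous h) (hinv_cont : continuous hinv).
Hypotheses (k_cont : continuous k) (l_cont : continuous l).

(* Near a point x of period p the germ of shift^p is expanding. If the sum of
   l were at most the sum of k along the orbit, its conjugate by h would map
   small cylinders around h x into themselves, so that every point close
   enough to x would follow x forever. *)
Lemma orbit_map_positive_on_cycles : condition_I A ->
  positive_on_cycles (nat_diff l_cont k_cont).
Proof.
move=> A_I x p p_gt0 xp.
have -> : birkhoff (nat_diff l_cont k_cont) p x =
    (time_sum l p x)%:Z - (time_sum k p x)%:Z.
  rewrite /birkhoff /time_sum sumrB.
  by rewrite -!(big_morph Posz PoszD (erefl _)).
rewrite subr_gt0 ltz_nat ltnNge; apply/negP => le_lk.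
set K := time_sum k p x in le_lk; set L := time_sum l p x in le_lk.
have [n1 kP] := time_sum_locally_constant p x k_cont.
have [n2 lP] := time_sum_locally_constant p x l_cont.
have [n3 hP] := continuous_agree K x h_cont.
(* [n1] and [n2] fix both time sums; [n3 + p] leaves [n3] common letters after [p] shifts and also
   gives [p <= n]. *)
pose n := maxn (maxn n1 n2) (n3 + p).
have [m mP] : exists m, forall z, agree m (h x) z -> agree n x (hinv z).
  have [m mP] := continuous_agree n (h x) hinv_cont.
  by exists m => z /mP; rewrite hK.
have step y : agree m (h x) (h y) ->
    agree n x y /\ agree m (h x) (h (iter p (@shift N A) y)).
  move=> hxy; have xy : agree n x y by have := mP _ hxy; rewrite hK.
  split=> // i i_lt.
  have kE : time_sum k p y = K.
    by apply/kP/(agree_leq _ xy); rewrite !leq_max leqnn.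
  have lE : time_sum l p y = L.
    by apply/lP/(agree_leq _ xy); rewrite !leq_max leqnn orbT.
  (* The first [K] letters are controlled by continuity of [h] at [x]. Later ones are letters
     [L + (i - K)] of [h x] and [h y], and [L <= K] keeps that index below [m]. *)
  have [i_lt_K|K_le_i] := ltnP i K.
    apply: hP i_lt_K; rewrite -xp; apply: agree_iter.
    by apply: agree_leq xy; rewrite addnC leq_maxr.
  have shE z : iter K (@shift M B) (h (iter p (@shift N A) z)) =
      iter L (@shift M B) (h z) ->
      letter (h (iter p (@shift N A) z)) i = letter (h z) (L + (i - K)).
    by move=> zE; rewrite -letter_iter -zE letter_iter subnKC.
  have xE : letter (h x) i = letter (h x) (L + (i - K)).
    by have := shE x (orbit_iter p x); rewrite xp.
  rewrite xE shE; last by rewrite -kE -lE orbit_iter.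
  by apply: hxy; lia.
have iter_step y q : agree m (h x) (h y) ->
    agree m (h x) (h (iter (q * p) (@shift N A) y)).
  by move=> hxy; elim: q => //= q IHq; rewrite mulSn iterD; case: (step _ IHq).
have xper q : iter (q * p) (@shift N A) x = x.
  by elim: q => //= q IHq; rewrite mulSn iterD IHq.
have [n4 xh] := continuous_agree m x h_cont.
have [y xy yx] := condition_I_no_isolated x n4 A_I; apply: yx.
(* Every iterate of [y] by a multiple of [p] shares at least [p] letters with [x], so all letters of
   [y] are those of [x]. *)
apply: markov_shift_eq => i; rewrite (divn_eq i p) -!letter_iter xper.
have [agr _] := step _ (iter_step _ (i %/ p)%N (xh _ xy)).
by apply: agr; rewrite (leq_trans (ltn_pmod _ p_gt0))// leq_max leq_addl orbT.
Qed.

End OrbitMap.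

Theorem proposition5p10 (N M : nat) (A : 'M[nat]_N) (B : 'M[nat]_M)
    (N_gt1 : (1 < N)%N) (M_gt1 : (1 < M)%N)
    (A01 : zero_one_matrix A) (B01 : zero_one_matrix B)
    (A_irr : irreducible A) (B_irr : irreducible B)
    (A_I : condition_I A) (B_I : condition_I B)
    (h : markov_shift A -> markov_shift B)
    (hinv : markov_shift B -> markov_shift A)
    (hK : cancel h hinv) (hinvK : cancel hinv h)
    (h_cont : continuous h) (hinv_cont : continuous hinv)
    (k1 l1 : markov_shift A -> nat) (k2 l2 : markov_shift B -> nat)
    (k1_cont : continuous k1) (l1_cont : continuous l1)
    (k2_cont : continuous k2) (l2_cont : continuous l2)
    (orbit1 : forall x : markov_shift A,
       iter (k1 x) (@shift M B) (h (@shift N A x)) =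
       iter (l1 x) (@shift M B) (h x))
    (orbit2 : forall y : markov_shift B,
       iter (k2 y) (@shift N A) (hinv (@shift M B y)) =
       iter (l2 y) (@shift N A) (hinv y)) :
  coh_pos (coh_class (nat_diff l1_cont k1_cont)) /\
  order_unit (@coh_pos N A) (coh_class (nat_diff l1_cont k1_cont)).
Proof.
have cpos := orbit_map_positive_on_cycles orbit1 hK h_cont hinv_cont
  k1_cont l1_cont A_I.
have u := order_unit_positive_on_cycles A01 A_irr cpos.
by split=> //; case: u.
Qed.
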